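(* Let $\mu,\nu\in\mathbb{H}$ satisfy $\mu^2=\nu^2=-1$ and $\mu\nu+\nu\mu=0$, let $\mathcal{F}=\mathcal{F}^{\mu,\nu}$ be the associated left quaternion Fourier transform, and let $f,g:\mathbb{R}^2\to\mathbb{H}$ be integrable quaternion functions. Then $$\begin{aligned} \mathcal{F}(f*g)=\frac{\pi}{2}\Big[&\mathcal{F}(f)\mathcal{F}(g)+\mathcal{F}(f)\mathcal{F}(g^{(0,1)})+\mathcal{F}(f)\mathcal{F}(g^{(1,0)})+\mathcal{F}(f)\mathcal{F}(g^{(1,1)})\\ &-\mathcal{F}(\nu f)\mathcal{F}(\nu g)+\mathcal{F}(\nu f)\mathcal{F}(\nu g^{(0,1)})-\mathcal{F}(\nu f)\mathcal{F}(\nu g^{(1,0)})+\mathcal{F}(\nu f)\mathcal{F}(\nu g^{(1,1)})\\ &-\mathcal{F}(\mu f^{(0,1)})\mathcal{F}(\mu g)-\mathcal{F}(\mu f^{(0,1)})\mathcal{F}(\mu g^{(0,1)})+\mathcal{F}(\mu f^{(0,1)})\mathcal{F}(\mu g^{(1,0)})+\mathcal{F}(\mu f^{(0,1)})\mathcal{F}(\mu g^{(1,1)})\\ &+\mathcal{F}(\nu\mu f^{(0,1)})\mathcal{F}(\mu\nu g)-\mathcal{F}(\nu\mu f^{(0,1)})\mathcal{F}(\mu\nu g^{(0,1)})\\ &-\mathcal{F}(\nu\mu f^{(0,1)})\mathcal{F}(\mu\nu g^{(1,0)})+\mathcal{F}(\nu\mu f^{(0,1)})\mathcal{F}(\mu\nu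 g^{(1,1)})\Big]. \end{aligned}$$
   Context: $\mathbb{H}$ is the algebra of real quaternions. Quaternion functions are functions $f=f_0+f_1\boldsymbol{i}+f_2\boldsymbol{j}+f_3\boldsymbol{k}:\mathbb{R}^2\to\mathbb{H}$ with $f_0,f_1,f_2,f_3\in L^1(\mathbb{R}^2)$ real-valued. For $q\in\mathbb{H}$, $qf$ is the pointwise left multiple. Products of transforms are pointwise quaternion products. Reflections: for $\phi=(\phi_1,\phi_2)\in\{0,1\}^2$, $f^{\phi}(x)=f((-1)^{\phi_1}x_1,(-1)^{\phi_2}x_2)$. Exponential: for $\mu^2=-1$ and $\theta\in\mathbb{R}$, $e^{\mu\theta}=\cos\theta+\mu\sin\theta$. Left quaternion Fourier transform: $\mathcal{F}^{\mu,\nu}(f)(y)=\frac{1}{2\pi}\int_{\mathbb{R}^2}e^{-\mu x_1y_1}e^{-\nu x_2y_2}f(x)\,dx$. Classical convolution: $(f*g)(x)=\int_{\mathbb{R}^2}f(y)g(x-y)\,dy$ (quaternion product in the integrand). *)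

(* Defs.v *)
From HB Require Import structures.
From mathcomp Require Import all_boot all_order all_algebra.
From mathcomp Require Import ring.
From mathcomp Require Import all_classical all_reals all_analysis.

Set Implicit Arguments.
Unset Strict Implicit.
Unset Printing Implicit Defensive.

Import Order.TTheory GRing.Theory Num.Theory.
Import numFieldNormedType.Exports.

Local Open Scope classical_set_scope.
Local Open Scope ring_scope.

(* [Quat a b c d] stands for a + b i + c j + d k. *)
Record quat (R : Type) : Type := Quat { q0 : R; q1 : R; q2 : R; q3 : R }.

Section QuaternionAlgebra.
Variable R : realType.

Definition prod_of_quat (q : quat R) : R * R * R * R := (q0 q, q1 q, q2 q, q3 q).
Definition quat_of_prod (t : R * R * R * R) : quat R :=
  Quat t.1.1.1 t.1.1.2 t.1.2 t.2.

Lemma prod_of_quatK : cancel prod_of_quat quat_of_prod.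
Proof. by case. Qed.

HB.instance Definition _ := Choice.copy (quat R) (can_type prod_of_quatK).

Definition quat_zero : quat R := Quat 0 0 0 0.
Definition quat_opp (p : quat R) := Quat (- q0 p) (- q1 p) (- q2 p) (- q3 p).
Definition quat_add (p q : quat R) :=
  Quat (q0 p + q0 q) (q1 p + q1 q) (q2 p + q2 q) (q3 p + q3 q).

Fact quat_addA : associative quat_add.
Proof. by move=> [????] [????] [????]; congr Quat; rewrite /= addrA. Qed.
Fact quat_addC : commutative quat_add.
Proof. by move=> [????] [????]; congr Quat; rewrite /= addrC. Qed.
Fact quat_add0 : left_id quat_zero quat_add.
Proof. by move=> [????]; congr Quat; rewrite /= add0r. Qed.
Fact quat_addN : left_inverse quat_zero quat_opp quat_add.
Proof. by move=> [????]; congr Quat; rewrite /= addNr. Qed.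

HB.instance Definition _ := GRing.isZmodule.Build (quat R)
  quat_addA quat_addC quat_add0 quat_addN.

Definition quat_one : quat R := Quat 1 0 0 0.
Definition quat_mul (p q : quat R) :=
  Quat (q0 p * q0 q - q1 p * q1 q - q2 p * q2 q - q3 p * q3 q)
       (q0 p * q1 q + q1 p * q0 q + q2 p * q3 q - q3 p * q2 q)
       (q0 p * q2 q - q1 p * q3 q + q2 p * q0 q + q3 p * q1 q)
       (q0 p * q3 q + q1 p * q2 q - q2 p * q1 q + q3 p * q0 q).

Fact quat_mulA : associative quat_mul.
Proof. by move=> [????] [????] [????]; congr Quat; rewrite /=; ring. Qed.
Fact quat_mul1l : left_id quat_one quat_mul.
Proof. by move=> [????]; congr Quat; rewrite /=; ring. Qed.
Fact quat_mul1r : right_id quat_one quat_mul.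
Proof. by move=> [????]; congr Quat; rewrite /=; ring. Qed.
Fact quat_mulDl : left_distributive quat_mul quat_add.
Proof. by move=> [????] [????] [????]; congr Quat; rewrite /=; ring. Qed.
Fact quat_mulDr : right_distributive quat_mul quat_add.
Proof. by move=> [????] [????] [????]; congr Quat; rewrite /=; ring. Qed.
Fact quat_one_neq0 : quat_one != 0.
Proof. by apply/eqP => -[] /eqP; rewrite oner_eq0. Qed.

HB.instance Definition _ := GRing.Zmodule_isNzRing.Build (quat R)
  quat_mulA quat_mul1l quat_mul1r quat_mulDl quat_mulDr quat_one_neq0.

Definition quat_scale (a : R) (p : quat R) :=
  Quat (a * q0 p) (a * q1 p) (a * q2 p) (a * q3 p).

Fact quat_scaleA a b p : quat_scale a (quat_scale b p) = quat_scale (a * b) p.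
Proof. by case: p => *; congr Quat; rewrite /= mulrA. Qed.
Fact quat_scale1 : left_id 1 quat_scale.
Proof. by move=> [????]; congr Quat; rewrite /= mul1r. Qed.
Fact quat_scaleDr : right_distributive quat_scale +%R.
Proof. by move=> a [????] [????]; congr Quat; rewrite /= mulrDr. Qed.
Fact quat_scaleDl p : {morph quat_scale^~ p : a b / a + b}.
Proof. by move=> a b; case: p => *; congr Quat; rewrite /= mulrDl. Qed.

HB.instance Definition _ := GRing.Zmodule_isLmodule.Build R (quat R)
  quat_scaleA quat_scale1 quat_scaleDr quat_scaleDl.

Fact quat_scaleAl (a : R) (p q : quat R) : a *: (p * q) = (a *: p) * q.
Proof. by case: p q => [????] [????]; congr Quat; rewrite /=; ring. Qed.

HB.instance Definition _ := GRing.Lmodule_isLalgebra.Build R (quat R) quat_scaleAl.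

Fact quat_scaleAr (a : R) (p q : quat R) : a *: (p * q) = p * (a *: q).
Proof. by case: p q => [????] [????]; congr Quat; rewrite /=; ring. Qed.

HB.instance Definition _ := GRing.Lalgebra_isAlgebra.Build R (quat R) quat_scaleAr.

Definition qi : quat R := Quat 0 1 0 0.
Definition qj : quat R := Quat 0 0 1 0.
Definition qk : quat R := Quat 0 0 0 1.

Lemma hamilton_relations :
  [/\ qi ^+ 2 = -1, qj ^+ 2 = -1, qk ^+ 2 = -1 & qi * qj * qk = -1].
Proof. by split; congr Quat; rewrite /=; ring. Qed.

Lemma quatE (p : quat R) :
  p = (q0 p)%:A + q1 p *: qi + q2 p *: qj + q3 p *: qk.
Proof. by case: p => *; congr Quat; rewrite /=; ring. Qed.

End QuaternionAlgebra.

Section QuaternionFourier.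
Variable R : realType.

Definition leb2 := ((@lebesgue_measure R) \x (@lebesgue_measure R))%E.

Definition qintegrable (f : R * R -> quat R) : Prop :=
  [/\ leb2.-integrable [set: R * R] (fun x => (q0 (f x))%:E),
      leb2.-integrable [set: R * R] (fun x => (q1 (f x))%:E),
      leb2.-integrable [set: R * R] (fun x => (q2 (f x))%:E) &
      leb2.-integrable [set: R * R] (fun x => (q3 (f x))%:E)].

(* Like [Rintegral], this is total; a component that is not integrable gets a
   default real value. *)
Definition qintegral (f : R * R -> quat R) : quat R :=
  Quat (\int[leb2]_x q0 (f x)) (\int[leb2]_x q1 (f x))
       (\int[leb2]_x q2 (f x)) (\int[leb2]_x q3 (f x)).

Definition reflection (phi : 'I_2 * 'I_2) (f : R * R -> quat R) :
    R * R -> quat R :=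
  fun x => f ((-1) ^+ phi.1 * x.1, (-1) ^+ phi.2 * x.2).

Definition qexp (mu : quat R) (theta : R) : quat R :=
  (cos theta)%:A + sin theta *: mu.

Definition qfourier (mu nu : quat R) (f : R * R -> quat R) (y : R * R) :
    quat R :=
  (2 * pi)^-1 *: qintegral (fun x =>
    qexp mu (- (x.1 * y.1)) * qexp nu (- (x.2 * y.2)) * f x).

(* For integrable [f] and [g] the integrand is integrable for almost every [x];
   the default value of [qintegral] is used on the remaining null set. *)
Definition qconv (f g : R * R -> quat R) : R * R -> quat R :=
  fun x => qintegral (fun y => f y * g (x - y)).

End QuaternionFourier.

Notation "f ^[ a , b ]" := (reflection (a, b) f)
  (at level 2, format "f ^[ a ,  b ]") : ring_scope.

(* Main.v *)
(** Writing K(x) = e^{-mu x1 y1} e^{-nu x2 y2}, Fubini and translation invariance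
    turn F(f * g)(y) into 1/(2 pi) times the integral of K(s + t) f(t) g(s).
    Since mu nu = - nu mu, moving mu across e^{-nu t2 y2} flips the sign of the
    exponent, so K(s + t) f(t) g(s) is a sum of four products, one for each
    choice of cos or sin of s1 y1 and of s2 y2: a kernel of f at t, in which
    the flip is a reflection of f, times a real trigonometric factor times g(s).
    Each trigonometric factor is a signed sum of K over the four reflections
    of s, times 1, nu, mu or mu nu. *)

Require Import Defs.
From HB Require Import structures.
From mathcomp Require Import all_boot all_order all_algebra.
From mathcomp Require Import ring.
From mathcomp Require Import all_classical all_reals all_analysis.
From mathcomp Require Import measurable_realfun.

Set Implicit Arguments.
Unset Strict Implicit.
Unset Printing Implicit Defensive.

Import Order.TTheory GRing.Theory Num.Theory.
Import numFieldNormedType.Exports.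

Local Open Scope classical_set_scope.
Local Open Scope ring_scope.

(** * Measure-preserving maps *)

Section MeasurePreserving.
Context d (T : measurableType d) (R : realType).
Variable m : {measure set T -> \bar R}.

Definition measure_preserving (phi : T -> T) :=
  measurable_fun setT phi /\
  forall A, measurable A -> pushforward m phi A = m A.

Variable phi : T -> T.
Hypothesis phiP : measure_preserving phi.
Local Open Scope ereal_scope.

(** The nonnegative case assumes no integrability, so it can be applied to [|f|] to show that
    [f \o phi] is integrable before signed integrals are compared. *)
Lemma ge0_integral_preserving (f : T -> \bar R) :
  measurable_fun setT f -> (forall x, 0 <= f x) ->
  \int[m]_x f (phi x) = \int[m]_x f x.
Proof.
move=> mf f0; case: phiP => mphi mpE.
have := @ge0_integral_pushforward _ _ T T R phi mphi m setT f measurableT mf.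
rewrite preimage_setT /comp => <-; last by move=> x _; exact: f0.
by apply: eq_measure_integral => A mA _; exact: mpE.
Qed.

Lemma integrable_preserving (f : T -> \bar R) :
  m.-integrable setT f -> m.-integrable setT (f \o phi).
Proof.
move=> /integrableP[mf fi]; apply/integrableP; split.
  by apply: measurableT_comp => //; case: phiP.
rewrite (le_lt_trans _ fi)// -(ge0_integral_preserving (f := abse \o f))//.
- exact: measurableT_comp.
- by move=> x; exact: abse_ge0.
Qed.

Lemma integral_preserving (f : T -> \bar R) : m.-integrable setT f ->
  \int[m]_x f (phi x) = \int[m]_x f x.
Proof.
move=> fi; have mf := measurable_int _ fi; case: (phiP) => mphi mpE.
have := integral_pushforward mphi (mu := m) (D := setT) mf.
rewrite preimage_setT => <- //; last exact: integrable_preserving.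
by apply: eq_measure_integral => A mA _; exact: mpE.
Qed.

End MeasurePreserving.

(** * Translations and sign changes of the real line *)

Section LebesguePreserving.
Variable R : realType.
Notation leb := (@lebesgue_measure R).

Lemma measure_preserving_shift (t : R) :
  measure_preserving leb (fun x => x - t).
Proof.
have mS : measurable_fun setT (fun x : measurableTypeR R => (x - t : measurableTypeR R)).
  exact: measurable_funB.
split=> // A mA; apply/esym.
(* Lebesgue measure is determined by its values on the intervals []a, b]], and the preimage of such
   an interval is []a + t, b + t]], of the same length. *)
apply: (lebesgue_measure_unique (mu := pushforward leb _)) => // _ [[a b]] _ <-.
rewrite /pushforward [X in _ = lebesgue_measure X](_ : _ = `]a + t, b + t]%classic).
  rewrite !lebesgue_measure_itv/= !lte_fin ltrD2r.
  by case: ifPn => // _; rewrite -!EFinB opprD addrACA subrr addr0.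
by apply/seteqP; split=> x /=; rewrite !in_itv/= ltrBrDr lerBlDr.
Qed.

Lemma measure_preserving_sign (n : nat) :
  measure_preserving leb (fun x => (-1) ^+ n * x).
Proof.
rewrite -signr_odd; case: (odd n); rewrite ?expr0 ?expr1; last first.
  rewrite (_ : (fun x => 1 * x) = id); last by apply/funext => x; rewrite mul1r.
  by split.
rewrite (_ : (fun x => -1 * x) = -%R); last by apply/funext => x; rewrite mulN1r.
split; first exact: oppr_measurable.
exact: lebesgue_measureN.
Qed.
End LebesguePreserving.

Section ProductPreserving.
Context d1 d2 (T1 : measurableType d1) (T2 : measurableType d2) (R : realType).
Variables (m1 : {sigma_finite_measure set T1 -> \bar R})
  (m2 : {sigma_finite_measure set T2 -> \bar R}).

Lemma measure_preserving_prod phi1 phi2 :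
  measure_preserving m1 phi1 -> measure_preserving m2 phi2 ->
  measure_preserving (m1 \x m2)%E (fun x => (phi1 x.1, phi2 x.2)).
Proof.
move=> [mp1 p1] [mp2 p2].
have mp : measurable_fun setT (fun x : T1 * T2 => (phi1 x.1, phi2 x.2)).
  by apply: measurable_fun_pair; exact: measurableT_comp.
split=> // A mA; apply/esym.
(* A product measure is determined by its values on rectangles, and the preimage of [B] times [C] is
   the rectangle of the two preimages. *)
apply: (product_measure_unique (m' := pushforward (m1 \x m2)%E _)) => //.
move=> B C mB mC; rewrite -p1// -p2//.
have mB' : measurable (phi1 @^-1` B) by rewrite -[X in measurable X]setTI; exact: mp1.
have mC' : measurable (phi2 @^-1` C) by rewrite -[X in measurable X]setTI; exact: mp2.
exact: (product_measure1E m1 m2 mB' mC').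
Qed.

Lemma sigma_finite_product : sigma_finite setT (m1 \x m2)%E.
Proof.
by have [] := lebesgue_integral_fubini.measure_function_Measure_isSigmaFinite__to__measure_function_isSigmaFinite m1 m2.
Qed.

(* The library's sigma-finite instance on [m1 \x m2] is shadowed by the one for
   pairs of subprobabilities, so unification does not find it. *)
Definition product_sigma_finite_measure :
    {sigma_finite_measure set (T1 * T2)%type -> \bar R} :=
  HB.pack (m1 \x m2)%E
    (Measure_isSigmaFinite.Build _ _ _ (m1 \x m2)%E sigma_finite_product).

End ProductPreserving.

(** * Real integrals *)

Section BoundedMeasurable.
Context d (T : measurableType d) (R : realType).
Implicit Types h k : T -> R.

(** A class of multipliers that preserve integrability; the components of the Fourier kernel belong
    to it. *)
Definition bounded_measurable h :=
  measurable_fun setT h /\ exists M, forall x, `|h x| <= M.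

Lemma bounded_measurable_cst c : bounded_measurable (fun=> c).
Proof. by split=> //; exists `|c|. Qed.

Lemma bounded_measurableD h k : bounded_measurable h -> bounded_measurable k ->
  bounded_measurable (fun x => h x + k x).
Proof.
move=> [mh [M hM]] [mk [N kN]]; split; first exact: measurable_funD.
by exists (M + N) => x; rewrite (le_trans (ler_normD _ _))// lerD.
Qed.

Lemma bounded_measurableM h k : bounded_measurable h -> bounded_measurable k ->
  bounded_measurable (fun x => h x * k x).
Proof.
move=> [mh [M hM]] [mk [N kN]]; split; first exact: measurable_funM.
by exists (M * N) => x; rewrite normrM ler_pM.
Qed.

Lemma bounded_measurableN h : bounded_measurable h ->
  bounded_measurable (fun x => - h x).
Proof.
move=> [mh [M hM]]; split; first exact: measurableT_comp.
by exists M => x; rewrite normrN.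
Qed.

Lemma bounded_measurable_cos h : measurable_fun setT h ->
  bounded_measurable (fun x => cos (h x)).
Proof.
move=> mh; split; last by exists 1 => x; rewrite ler_norml cos_geN1 cos_le1.
apply: measurableT_comp => //; apply: continuous_measurable_fun.
exact: continuous_cos.
Qed.

Lemma bounded_measurable_sin h : measurable_fun setT h ->
  bounded_measurable (fun x => sin (h x)).
Proof.
move=> mh; split; last by exists 1 => x; rewrite ler_norml sin_geN1 sin_le1.
apply: measurableT_comp => //; apply: continuous_measurable_fun.
exact: continuous_sin.
Qed.

End BoundedMeasurable.

Lemma bounded_measurable_comp d1 d2 (T1 : measurableType d1)
    (T2 : measurableType d2) (R : realType) (phi : T1 -> T2) (h : T2 -> R) :
  measurable_fun setT phi -> bounded_measurable h ->
  bounded_measurable (fun x => h (phi x)).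
Proof.
by move=> mphi [mh [M hM]]; split; [exact: measurableT_comp|exists M => x].
Qed.

Section RealIntegral.
Context d (T : measurableType d) (R : realType).
Variable m : {measure set T -> \bar R}.
Implicit Types h k : T -> R.

Definition rintegrable h := m.-integrable setT (fun x => (h x)%:E).

Lemma rintegrableD h k : rintegrable h -> rintegrable k ->
  rintegrable (fun x => h x + k x).
Proof. by move=> hi ki; exact: (integrableD measurableT hi ki). Qed.

Lemma rintegrableB h k : rintegrable h -> rintegrable k ->
  rintegrable (fun x => h x - k x).
Proof. by move=> hi ki; exact: (integrableB measurableT hi ki). Qed.

Lemma rintegrableM h k : bounded_measurable h -> rintegrable k ->
  rintegrable (fun x => h x * k x).
Proof.
move=> [mh [M hM]] ki; apply: (integrableMr measurableT mh _ ki).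
exists M; split; first exact: num_real.
by move=> N /ltW MN x _ /=; rewrite (le_trans (hM x)).
Qed.

Lemma rintegrableZ c h : rintegrable h -> rintegrable (fun x => c * h x).
Proof. exact/rintegrableM/bounded_measurable_cst. Qed.

Lemma rintegrableZr c h : rintegrable h -> rintegrable (fun x => h x * c).
Proof. by move=> hi; under eq_fun do rewrite mulrC; exact: rintegrableZ. Qed.

Lemma rintegrable_measurable h : rintegrable h -> measurable_fun setT h.
Proof. by move=> /(@measurable_int _ _ _ m) /measurable_EFinP. Qed.

Lemma ae_eq_Rintegral h k : measurable_fun setT h -> measurable_fun setT k ->
  {ae m, forall x, h x = k x} -> \int[m]_x h x = \int[m]_x k x.
Proof.
move=> mh mk hk; congr fine; apply: ae_eq_integral => //.
- exact/measurable_EFinP.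
- exact/measurable_EFinP.
- by apply: filterS hk => x -> _.
Qed.

End RealIntegral.

Section RealFubini.
Context d1 d2 (T1 : measurableType d1) (T2 : measurableType d2) (R : realType).
Variables (m1 : {sigma_finite_measure set T1 -> \bar R})
  (m2 : {sigma_finite_measure set T2 -> \bar R}).
Variable h : T1 * T2 -> R.
Hypothesis hi : rintegrable (m1 \x m2)%E h.

Lemma measurable_Rintegral : measurable_fun setT (fun x => \int[m2]_y h (x, y)).
Proof.
have mF := measurable_fubini_F hi.
exact: measurableT_comp (@fine_measurable R setT measurableT) mF.
Qed.

(** The real inner integral is [fine] of the extended one. The two agree where the section is
    integrable, hence almost everywhere; on the remaining null set the extended value may be
    infinite and [fine] turns it into 0. *)
Lemma Rintegral_fubini :
  \int[m1]_x \int[m2]_y h (x, y) = \int[m2]_y \int[m1]_x h (x, y).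
Proof.
congr fine; transitivity (\int[m1]_x \int[m2]_y (h (x, y))%:E)%E.
  apply: ae_eq_integral => //.
  - apply/measurable_EFinP; exact: measurable_Rintegral.
  - exact: measurable_fubini_F hi.
  - apply: filterS (ae_integrable1 hi) => x hx _.
    by rewrite fineK//; exact: integrable_fin_num.
transitivity (\int[m2]_y \int[m1]_x (h (x, y))%:E)%E; first exact: Fubini hi.
apply: ae_eq_integral => //.
- exact: measurable_fubini_G hi.
- apply/measurable_EFinP.
  exact: measurableT_comp (@fine_measurable R setT measurableT)
    (measurable_fubini_G hi).
- apply: filterS (ae_integrable2 hi) => x hx _.
  by rewrite fineK//; exact: integrable_fin_num.
Qed.

End RealFubini.

(** * Joint integrability of the convolution integrand *)

Section ConvolutionIntegrable.
Context d (T : measurableType d) (R : realType).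
Variable m : {sigma_finite_measure set T -> \bar R}.
Variable sub : T * T -> T.
Hypothesis msub : measurable_fun setT sub.
Hypothesis subP : forall t, measure_preserving m (fun x => sub (x, t)).

(** Here [sub] abstracts the map sending (x, t) to x - t. By Tonelli, the absolute value may be
    integrated in x first: invariance turns the inner integral into [|f t|] times the L1 norm of
    [g], and the outer one then yields the product of the two norms. *)
Lemma rintegrable_convolution (f g : T -> R) :
  rintegrable m f -> rintegrable m g ->
  rintegrable (m \x m)%E (fun p => f p.2 * g (sub p)).
Proof.
move=> fi gi; have mf := rintegrable_measurable fi.
have mg := rintegrable_measurable gi.
apply/integrable21ltyP.
  apply/measurable_EFinP/measurable_funM; first exact: measurableT_comp.
  exact: measurableT_comp.
have mabs (k : T -> R) : measurable_fun setT k ->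
    measurable_fun setT (fun x : T => `|k x|%:E).
  by move=> mk; apply/measurable_EFinP; exact: measurableT_comp.
have inner t : (\int[m]_x `|(f t * g (sub (x, t)))%:E| =
    `|f t|%:E * \int[m]_x `|g x|%:E)%E.
  have -> : (\int[m]_x `|g x|%:E = \int[m]_x `|g (sub (x, t))|%:E)%E.
    apply/esym/(ge0_integral_preserving (subP t) (f := fun x => `|g x|%:E)) => [|x].
    - exact: mabs.
    - by rewrite lee_fin.
  rewrite -ge0_integralZl//.
  - by apply: eq_integral => x _; rewrite /= normrM EFinM.
  - by apply: (mabs (g \o (fun x => sub (x, t)))); apply: measurableT_comp => //;
      have [] := subP t.
rewrite /= (eq_integral _ _ (fun t _ => inner t)).
case/integrableP: fi => _ fi; case/integrableP: gi => _ gi.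
rewrite ge0_integralZr//; last 2 first.
- exact: mabs.
- by apply: integral_ge0 => x _; rewrite lee_fin.
have fin (k : T -> R) :
    (\int[m]_x `|(k x)%:E| < +oo -> \int[m]_x `|k x|%:E \is a fin_num)%E.
  by move=> ki; rewrite ge0_fin_numE//; apply: integral_ge0 => x _; rewrite lee_fin.
rewrite -ge0_fin_numE ?fin_numM ?fin// mule_ge0//;
  by apply: integral_ge0 => x _; rewrite lee_fin.
Qed.

End ConvolutionIntegrable.

(** * Quaternion integrals *)

Section QuaternionIntegral.
Context d (T : measurableType d) (R : realType).
Implicit Types (A h k : T -> quat R).

Definition quat_measurable h :=
  [/\ measurable_fun setT (fun x => q0 (h x)), measurable_fun setT (fun x => q1 (h x)),
      measurable_fun setT (fun x => q2 (h x)) & measurable_fun setT (fun x => q3 (h x))].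

Definition quat_bounded_measurable A :=
  [/\ bounded_measurable (fun x => q0 (A x)), bounded_measurable (fun x => q1 (A x)),
      bounded_measurable (fun x => q2 (A x)) & bounded_measurable (fun x => q3 (A x))].

Lemma quat_bounded_measurable_cst p : quat_bounded_measurable (fun=> p).
Proof. by split; exact: bounded_measurable_cst. Qed.

Lemma quat_bounded_measurableM A h :
  quat_bounded_measurable A -> quat_bounded_measurable h ->
  quat_bounded_measurable (fun x => A x * h x).
Proof.
move=> [? ? ? ?] [? ? ? ?]; split; rewrite /=;
  by repeat first [ apply: bounded_measurableD | apply: bounded_measurableM
    | apply: bounded_measurableN | assumption ].
Qed.

Lemma quat_bounded_measurable_exp mu (a : T -> R) : measurable_fun setT a ->
  quat_bounded_measurable (fun x => qexp mu (a x)).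
Proof.
move=> ma; split; rewrite /=;
  by repeat first [ apply: bounded_measurableD | apply: bounded_measurableM
    | apply: bounded_measurable_cst | apply: bounded_measurable_cos
    | apply: bounded_measurable_sin | assumption ].
Qed.

Lemma quat_measurableM A h : quat_measurable A -> quat_measurable h ->
  quat_measurable (fun x => A x * h x).
Proof.
move=> [? ? ? ?] [? ? ? ?]; split; rewrite /=;
  by repeat first [ apply: measurable_funB | apply: measurable_funD
    | apply: measurable_funM | assumption ].
Qed.

Lemma quat_bounded_measurableW A : quat_bounded_measurable A -> quat_measurable A.
Proof. by move=> [[? _] [? _] [? _] [? _]]. Qed.

Variable m : {measure set T -> \bar R}.

(** This and [quat_integral] extend [qintegrable] and [qintegral] to an arbitrary measure, so that
    Fubini can be stated on products; for the Lebesgue measure of the plane they unfold to the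
    originals. *)
Definition quat_integrable h :=
  [/\ rintegrable m (fun x => q0 (h x)), rintegrable m (fun x => q1 (h x)),
      rintegrable m (fun x => q2 (h x)) & rintegrable m (fun x => q3 (h x))].

Definition quat_integral h : quat R :=
  Quat (\int[m]_x q0 (h x)) (\int[m]_x q1 (h x))
       (\int[m]_x q2 (h x)) (\int[m]_x q3 (h x)).

Lemma eq_quat_integral h k : h =1 k -> quat_integral h = quat_integral k.
Proof. by move=> /funext ->. Qed.

Lemma ae_eq_quat_integral h k : quat_measurable h -> quat_measurable k ->
  {ae m, forall x, h x = k x} -> quat_integral h = quat_integral k.
Proof.
move=> [? ? ? ?] [? ? ? ?] hk; rewrite /quat_integral.
by congr Quat; apply: ae_eq_Rintegral => //; apply: filterS hk => x ->.
Qed.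

Lemma quat_integrableD h k : quat_integrable h -> quat_integrable k ->
  quat_integrable (fun x => h x + k x).
Proof. by move=> [????] [????]; split; exact: rintegrableD. Qed.

Lemma quat_integrableMl A h : quat_bounded_measurable A -> quat_integrable h ->
  quat_integrable (fun x => A x * h x).
Proof.
move=> [????] [????]; split; rewrite /=;
  by repeat first [ apply: rintegrableB | apply: rintegrableD
    | apply: rintegrableM | assumption ].
Qed.

Lemma quat_integralD h k : quat_integrable h -> quat_integrable k ->
  quat_integral (fun x => h x + k x) = quat_integral h + quat_integral k.
Proof.
by move=> [????] [????]; congr Quat; apply: RintegralD.
Qed.

(** Every component of [p * h] and of [h * p] is a combination of this shape. *)
Lemma Rintegral_lin4 (a b c e : R) (h0 h1 h2 h3 : T -> R) :
  rintegrable m h0 -> rintegrable m h1 -> rintegrable m h2 -> rintegrable m h3 ->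
  \int[m]_x (a * h0 x + b * h1 x + c * h2 x + e * h3 x) =
  a * \int[m]_x h0 x + b * \int[m]_x h1 x + c * \int[m]_x h2 x +
  e * \int[m]_x h3 x.
Proof.
move=> i0 i1 i2 i3.
do 3![rewrite RintegralD//;
  [|by repeat first [exact: rintegrableZ | apply: rintegrableD]
   |exact: rintegrableZ]].
by rewrite !RintegralZl.
Qed.

(** The coefficients in the four cases are the rows of the matrix of left multiplication by [p]. The
    product does not commute, so [quat_integralMr] repeats the argument with the matrix of right
    multiplication. *)
Lemma quat_integralMl p h : quat_integrable h ->
  quat_integral (fun x => p * h x) = p * quat_integral h.
Proof.
case: p => a b c e [i0 i1 i2 i3]; rewrite /quat_integral; congr Quat => /=.
- transitivity (\int[m]_x (a * q0 (h x) + (- b) * q1 (h x) + (- c) * q2 (h x)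
    + (- e) * q3 (h x))); last by rewrite Rintegral_lin4//; ring.
  by apply: eq_Rintegral => x _ /=; ring.
- transitivity (\int[m]_x (b * q0 (h x) + a * q1 (h x) + (- e) * q2 (h x)
    + c * q3 (h x))); last by rewrite Rintegral_lin4//; ring.
  by apply: eq_Rintegral => x _ /=; ring.
- transitivity (\int[m]_x (c * q0 (h x) + e * q1 (h x) + a * q2 (h x)
    + (- b) * q3 (h x))); last by rewrite Rintegral_lin4//; ring.
  by apply: eq_Rintegral => x _ /=; ring.
- transitivity (\int[m]_x (e * q0 (h x) + (- c) * q1 (h x) + b * q2 (h x)
    + a * q3 (h x))); last by rewrite Rintegral_lin4//; ring.
  by apply: eq_Rintegral => x _ /=; ring.
Qed.

Lemma quat_integralMr p h : quat_integrable h ->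
  quat_integral (fun x => h x * p) = quat_integral h * p.
Proof.
case: p => a b c e [i0 i1 i2 i3]; rewrite /quat_integral; congr Quat => /=.
- transitivity (\int[m]_x (a * q0 (h x) + (- b) * q1 (h x) + (- c) * q2 (h x)
    + (- e) * q3 (h x))); last by rewrite Rintegral_lin4//; ring.
  by apply: eq_Rintegral => x _ /=; ring.
- transitivity (\int[m]_x (b * q0 (h x) + a * q1 (h x) + e * q2 (h x)
    + (- c) * q3 (h x))); last by rewrite Rintegral_lin4//; ring.
  by apply: eq_Rintegral => x _ /=; ring.
- transitivity (\int[m]_x (c * q0 (h x) + (- e) * q1 (h x) + a * q2 (h x)
    + b * q3 (h x))); last by rewrite Rintegral_lin4//; ring.
  by apply: eq_Rintegral => x _ /=; ring.
- transitivity (\int[m]_x (e * q0 (h x) + c * q1 (h x) + (- b) * q2 (h x)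
    + a * q3 (h x))); last by rewrite Rintegral_lin4//; ring.
  by apply: eq_Rintegral => x _ /=; ring.
Qed.

Lemma quat_integrableMr p h : quat_integrable h ->
  quat_integrable (fun x => h x * p).
Proof.
case: p => a b c e [????]; split; rewrite /=;
 by repeat first [ apply: rintegrableB | apply: rintegrableD
   | apply: rintegrableZr | assumption ].
Qed.

Lemma quat_integral_preserving phi h : measure_preserving m phi ->
  quat_integrable h -> quat_integral (h \o phi) = quat_integral h.
Proof.
move=> phiP [i0 i1 i2 i3]; rewrite /quat_integral /Rintegral /=.
congr Quat; congr fine.
- exact: (integral_preserving phiP i0).
- exact: (integral_preserving phiP i1).
- exact: (integral_preserving phiP i2).
- exact: (integral_preserving phiP i3).
Qed.

(** The expanded kernel has this form. For fixed [t] each [A] is a constant on the left of the inner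
    integral; each integral of a [B] is then a constant on the right of the outer one. *)
Lemma quat_integral_separable4 (p : quat R) (A1 A2 A3 A4 : T -> quat R)
    (B1 B2 B3 B4 : T -> quat R) :
  quat_integrable A1 -> quat_integrable A2 ->
  quat_integrable A3 -> quat_integrable A4 ->
  quat_integrable B1 -> quat_integrable B2 ->
  quat_integrable B3 -> quat_integrable B4 ->
  quat_integral (fun t => quat_integral (fun s =>
    p * (A1 t * B1 s + A2 t * B2 s + A3 t * B3 s + A4 t * B4 s))) =
  p * (quat_integral A1 * quat_integral B1 + quat_integral A2 * quat_integral B2
    + quat_integral A3 * quat_integral B3 + quat_integral A4 * quat_integral B4).
Proof.
move=> a1 a2 a3 a4 b1 b2 b3 b4.
have Z c B : quat_integrable B -> quat_integrable (fun s => c * B s).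
  by apply: quat_integrableMl; exact: quat_bounded_measurable_cst.
rewrite (eq_quat_integral (k := fun t => p * (A1 t * quat_integral B1
  + A2 t * quat_integral B2 + A3 t * quat_integral B3 + A4 t * quat_integral B4)));
  last first.
  move=> t; rewrite quat_integralMl; last first.
    by do !apply: quat_integrableD; exact: Z.
  congr (_ * _); rewrite !quat_integralD; do ?[exact: Z | apply: quat_integrableD].
  by rewrite !quat_integralMl.
rewrite quat_integralMl; last first.
  by do !apply: quat_integrableD; exact: quat_integrableMr.
congr (_ * _); rewrite !quat_integralD;
  do ?[exact: quat_integrableMr | apply: quat_integrableD].
by rewrite !quat_integralMr.
Qed.

End QuaternionIntegral.

Section QuaternionFubini.
Context d1 d2 (T1 : measurableType d1) (T2 : measurableType d2) (R : realType).
Variables (m1 : {sigma_finite_measure set T1 -> \bar R})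
  (m2 : {sigma_finite_measure set T2 -> \bar R}).
Variable h : T1 * T2 -> quat R.
Hypothesis hi : quat_integrable (m1 \x m2)%E h.

Lemma quat_measurable_integral :
  quat_measurable (fun x => quat_integral m2 (fun y => h (x, y))).
Proof.
case: hi => i0 i1 i2 i3; split.
- exact: (measurable_Rintegral i0).
- exact: (measurable_Rintegral i1).
- exact: (measurable_Rintegral i2).
- exact: (measurable_Rintegral i3).
Qed.

Lemma quat_integral_fubini :
  quat_integral m1 (fun x => quat_integral m2 (fun y => h (x, y))) =
  quat_integral m2 (fun y => quat_integral m1 (fun x => h (x, y))).
Proof.
case: hi => i0 i1 i2 i3; rewrite /quat_integral /=; congr Quat.
- exact: (Rintegral_fubini i0).
- exact: (Rintegral_fubini i1).
- exact: (Rintegral_fubini i2).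
- exact: (Rintegral_fubini i3).
Qed.

Lemma ae_quat_integrable :
  {ae m1, forall x, quat_integrable m2 (fun y => h (x, y))}.
Proof.
case: hi => i0 i1 i2 i3.
near=> x; split; near: x.
- exact: (ae_integrable1 i0).
- exact: (ae_integrable1 i1).
- exact: (ae_integrable1 i2).
- exact: (ae_integrable1 i3).
Unshelve. all: by end_near. Qed.

End QuaternionFubini.

(** * Integrating a convolution against a bounded kernel *)

Section QuaternionConvolution.
Context d (T : measurableType d) (R : realType).
Variable m : {sigma_finite_measure set T -> \bar R}.
Variable sub : T * T -> T.
Hypothesis msub : measurable_fun setT sub.
Hypothesis subP : forall t, measure_preserving m (fun x => sub (x, t)).
Variables (f g : T -> quat R).
Hypotheses (fi : quat_integrable m f) (gi : quat_integrable m g).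

Lemma quat_integrable_convolution :
  quat_integrable (m \x m)%E (fun p => f p.2 * g (sub p)).
Proof.
have C := rintegrable_convolution msub subP.
case: fi gi => [????] [????]; split => /=;
  by repeat first [ apply: rintegrableB | apply: rintegrableD
    | exact: (C (fun x => _ (f x)) (fun x => _ (g x))) ].
Qed.

(** The factor [A x] enters the inner integral for almost every [x], namely where the section is
    integrable; on the other points default values intervene, so the integrands are compared almost
    everywhere. Fubini then swaps the order. *)
Lemma quat_integral_convolution (A : T -> quat R) : quat_bounded_measurable A ->
  quat_integral m (fun x => A x * quat_integral m (fun t => f t * g (sub (x, t)))) =
  quat_integral m (fun t =>
    quat_integral m (fun x => A x * (f t * g (sub (x, t))))).
Proof.
move=> Ab; have ci := quat_integrable_convolution.
have Aci : quat_integrable (m \x m)%E (fun p => A p.1 * (f p.2 * g (sub p))).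
  apply: quat_integrableMl ci; case: Ab => a0 a1 a2 a3.
  have C := bounded_measurable_comp (@measurable_fst _ _ T T).
  by split; [exact: (C _ _ a0)|exact: (C _ _ a1)|exact: (C _ _ a2)|exact: (C _ _ a3)].
rewrite -(quat_integral_fubini Aci); apply: ae_eq_quat_integral.
- apply: quat_measurableM; first exact: quat_bounded_measurableW.
  exact: (quat_measurable_integral ci).
- exact: (quat_measurable_integral Aci).
- by apply: filterS (ae_quat_integrable ci) => x hx;
  rewrite /= (quat_integralMl (A x) hx).
Qed.

End QuaternionConvolution.

(** * Quaternion exponentials *)

Section QuaternionExponential.
Variable R : realType.
Implicit Types (mu nu p q : quat R) (a b c s : R).

Lemma qexpD mu a b : mu ^+ 2 = -1 -> qexp mu (a + b) = qexp mu a * qexp mu b.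
Proof.
rewrite expr2 => mu2.
(* With [mu * mu] kept as a symbol the expansion holds for every [mu] and can be checked by
   components; [mu * mu = -1] then leaves the addition formulas. *)
have -> : qexp mu a * qexp mu b = (cos a * cos b)%:A
    + (sin a * sin b) *: (mu * mu) + (sin a * cos b + cos a * sin b) *: mu.
  rewrite /qexp; move: (cos a) (cos b) (sin a) (sin b) => *.
  by case: mu {mu2} => *; congr Quat; rewrite /=; ring.
by rewrite mu2 /qexp cosD sinD scalerN -scalerBl.
Qed.

(** [mu] commutes with the real cosine term and anticommutes with the sine term, a multiple of
    [nu]. *)
Lemma qexp_anticomm mu nu a : mu * nu + nu * mu = 0 ->
  mu * qexp nu a = qexp nu (- a) * mu.
Proof.
move=> /eqP; rewrite addr_eq0 => /eqP mn.
rewrite /qexp cosN sinN mulrDr mulrDl -!scalerAl -!scalerAr mn mul1r mulr1.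
by rewrite scalerN scaleNr.
Qed.

(** [k a b] is the sum of [cos a * cos b] and of multiples of [mu], [nu] and [mu * nu], which differ
    in parity in [a] and [b]. A signed sum over the four sign changes keeps four times one of these
    terms. In the next three lemmas the right factor squares the surviving unit. *)
Lemma sum_cos_cos mu nu c d :
  let k a b := qexp mu a * qexp nu b in
  k (- c) (- d) + k (- c) d + k c (- d) + k c d = (4 * (cos c * cos d))%:A.
Proof.
rewrite /= /qexp !cosN !sinN; move: (cos c) (cos d) (sin c) (sin d) => *.
by case: mu nu => [????] [????]; congr Quat; rewrite /=; ring.
Qed.

Lemma sum_cos_sin mu nu c d :
  let k a b := qexp mu a * qexp nu b in
  (- k (- c) (- d) + k (- c) d - k c (- d) + k c d) * nu =
  (4 * (cos c * sin d)) *: nu ^+ 2.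
Proof.
rewrite expr2 /= /qexp !cosN !sinN; move: (cos c) (cos d) (sin c) (sin d) => *.
by case: mu nu => [????] [????]; congr Quat; rewrite /=; ring.
Qed.

Lemma sum_sin_cos mu nu c d :
  let k a b := qexp mu a * qexp nu b in
  (- k (- c) (- d) - k (- c) d + k c (- d) + k c d) * mu =
  (4 * (sin c * cos d)) *: mu ^+ 2.
Proof.
rewrite expr2 /= /qexp !cosN !sinN; move: (cos c) (cos d) (sin c) (sin d) => *.
by case: mu nu => [????] [????]; congr Quat; rewrite /=; ring.
Qed.

Lemma sum_sin_sin mu nu c d :
  let k a b := qexp mu a * qexp nu b in
  (k (- c) (- d) - k (- c) d - k c (- d) + k c d) * (mu * nu) =
  (4 * (sin c * sin d)) *: (mu * nu) ^+ 2.
Proof.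
rewrite expr2 /= /qexp !cosN !sinN; move: (cos c) (cos d) (sin c) (sin d) => *.
by case: mu nu => [????] [????]; congr Quat; rewrite /=; ring.
Qed.

Lemma qexp_kernelD mu nu a b c d :
  mu ^+ 2 = -1 -> nu ^+ 2 = -1 -> mu * nu + nu * mu = 0 ->
  4 *: (qexp mu (- (c + a)) * qexp nu (- (d + b))) =
    (4 * (cos c * cos d)) *: (qexp mu (- a) * qexp nu (- b))
    - (4 * (cos c * sin d)) *: (qexp mu (- a) * qexp nu (- b) * nu)
    - (4 * (sin c * cos d)) *: (qexp mu (- a) * qexp nu b * mu)
    - (4 * (sin c * sin d)) *: (qexp mu (- a) * qexp nu b * (nu * mu)).
Proof.
move=> mu2 nu2 mn; rewrite addrC (addrC d) !opprD !qexpD//.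
(* [a], [b] belong to the variable of [f], and [c], [d] to that of [g]. The exponential in [c]
   stands left of the one in [b]; its sine part carries [mu] across and flips [b]. *)
have step : qexp mu (- c) * qexp nu (- b) =
    cos c *: qexp nu (- b) - sin c *: (qexp nu b * mu).
  rewrite {1}/qexp cosN sinN mulrDl mulr_algl -scalerAl.
  by rewrite (qexp_anticomm (- b) mn) opprK scaleNr.
rewrite -mulrA (mulrA (qexp mu (- c))) step {step}.
move/eqP: mn; rewrite addrC addr_eq0 => /eqP ->.
rewrite [qexp nu (- d)]/qexp !cosN !sinN.
move: (cos c) (cos d) (sin c) (sin d) (qexp mu _) (qexp nu (- b)) (qexp nu b).
move=> C D S T [????] [????] [????]; case: mu nu {mu2 nu2} => [????] [????].
by congr Quat; rewrite /=; ring.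
Qed.

End QuaternionExponential.

(** * The Fourier kernel *)

Section FourierKernel.
Variable R : realType.
Implicit Types (mu nu p : quat R) (f g h : R * R -> quat R).

Notation leb := (@lebesgue_measure R).
(* [R * R] would elaborate to another, merely convertible measurable structure,
   on which unification with [leb \x leb] diverges. *)
Notation plane := (measurableTypeR R * measurableTypeR R)%type.
Notation m := (leb \x leb)%E.

Definition qkernel mu nu (y x : R * R) : quat R :=
  qexp mu (- (x.1 * y.1)) * qexp nu (- (x.2 * y.2)).

Definition plane_sign (phi : 'I_2 * 'I_2) (x : R * R) : R * R :=
  ((-1) ^+ phi.1 * x.1, (-1) ^+ phi.2 * x.2).

Lemma plane_signK phi : involutive (plane_sign phi).
Proof. by case=> a b; rewrite /plane_sign /= !signrMK. Qed.

Lemma plane_sign_preserving phi : measure_preserving m (plane_sign phi).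
Proof.
exact: (measure_preserving_prod (measure_preserving_sign R phi.1)
  (measure_preserving_sign R phi.2)).
Qed.

Lemma plane_shift_preserving (t : plane) :
  measure_preserving m (fun x : plane => ((x.1 - t.1, x.2 - t.2) : plane)).
Proof.
exact: (measure_preserving_prod (measure_preserving_shift t.1)
  (measure_preserving_shift t.2)).
Qed.

Lemma measurable_plane_sub : measurable_fun setT
  (fun p : plane * plane => ((p.1.1 - p.2.1, p.1.2 - p.2.2) : plane)).
Proof.
apply: measurable_fun_pair; apply: measurable_funB.
- exact: measurableT_comp measurable_fst measurable_fst.
- exact: measurableT_comp measurable_fst measurable_snd.
- exact: measurableT_comp measurable_snd measurable_fst.
- exact: measurableT_comp measurable_snd measurable_snd.
Qed.

Lemma measurable_affine (a b c : R) :
  measurable_fun setT (fun r : R => - ((a * r + b) * c)).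
Proof.
apply: continuous_measurable_fun => x.
by apply: cvgN; apply: cvgM; [apply: cvgD; [apply: cvgM|]|];
  first [exact: cvg_id | exact: cvg_cst].
Qed.

(** One affine family covers both the reflected and the translated kernels. *)
Lemma qkernel_affine_bounded mu nu y (a1 a2 b1 b2 : R) :
  quat_bounded_measurable (fun x : plane =>
    qkernel mu nu y (a1 * x.1 + b1, a2 * x.2 + b2)).
Proof.
apply: quat_bounded_measurableM; apply: quat_bounded_measurable_exp.
- exact: measurableT_comp (measurable_affine _ _ _) measurable_fst.
- exact: measurableT_comp (measurable_affine _ _ _) measurable_snd.
Qed.

Lemma qkernel_sign_bounded mu nu y phi :
  quat_bounded_measurable (fun x : plane => qkernel mu nu y (plane_sign phi x)).
Proof.
have := qkernel_affine_bounded mu nu y ((-1) ^+ phi.1) ((-1) ^+ phi.2) 0 0.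
by congr quat_bounded_measurable; apply/funext => x; rewrite !addr0.
Qed.

Lemma qkernel_shift_bounded mu nu y t :
  quat_bounded_measurable (fun x : plane => qkernel mu nu y (x + t)).
Proof.
have := qkernel_affine_bounded mu nu y 1 1 t.1 t.2.
by congr quat_bounded_measurable; apply/funext => x; rewrite !mul1r.
Qed.

Lemma qkernel_bounded_measurable mu nu y :
  quat_bounded_measurable (fun x : plane => qkernel mu nu y x).
Proof.
have := qkernel_shift_bounded mu nu y 0.
by congr quat_bounded_measurable; apply/funext => x; rewrite addr0.
Qed.

(** The sign change sits on the kernel rather than on [h], so that sums of reflected kernels can be
    integrated against a single [h]. *)
Definition qkernel_integral mu nu y (a b : 'I_2) h : quat R :=
  quat_integral m (fun x => qkernel mu nu y (plane_sign (a, b) x) * h x).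

(** A sign change is an involution that preserves the measure, so a change of variable moves it from
    [h] to the kernel. *)
Lemma qfourier_reflection mu nu a b h y : qintegrable h ->
  qfourier mu nu (reflection (a, b) h) y =
  (2 * pi)^-1 *: qkernel_integral mu nu y a b h.
Proof.
move=> hi; congr (_ *: _).
rewrite /qkernel_integral -(quat_integral_preserving (plane_sign_preserving (a, b))).
  apply: eq_quat_integral => x.
  by rewrite /comp plane_signK.
exact: quat_integrableMl (qkernel_sign_bounded mu nu y (a, b)) hi.
Qed.

Lemma qfourierE mu nu h y : qintegrable h ->
  qfourier mu nu h y = (2 * pi)^-1 *: qkernel_integral mu nu y 0 0 h.
Proof.
move=> hi; rewrite -(qfourier_reflection mu nu 0 0 y hi).
suff -> : reflection (0, 0) h = h by [].
by apply/funext => -[x1 x2]; rewrite /reflection !mul1r.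
Qed.

Lemma qintegrableZ p h : qintegrable h -> qintegrable (p \*o h).
Proof.
by apply: quat_integrableMl; exact: quat_bounded_measurable_cst.
Qed.

Lemma qfourier_convolution mu nu f g y :
  quat_integrable m f -> quat_integrable m g ->
  qfourier mu nu (qconv f g) y = (2 * pi)^-1 *: quat_integral m (fun t =>
    quat_integral m (fun s => qkernel mu nu y (s + t) * (f t * g s))).
Proof.
move=> fi gi; congr (_ *: _).
etransitivity.
  exact: (quat_integral_convolution (m := product_sigma_finite_measure leb leb)
    measurable_plane_sub plane_shift_preserving fi gi
    (qkernel_bounded_measurable mu nu y)).
apply: eq_quat_integral => t.
(* For fixed [t], translation invariance replaces [s] by [x - t] on the right-hand side, and the
   kernel argument becomes [x - t + t]. *)
rewrite -(quat_integral_preserving (plane_shift_preserving t)); last first.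
  apply: quat_integrableMl; first exact: qkernel_shift_bounded.
  apply: quat_integrableMl gi; exact: quat_bounded_measurable_cst.
apply: eq_quat_integral => x; rewrite /comp /=.
by rewrite -[(x.1 - t.1, _)]/(x - t) subrK.
Qed.

(** The coefficients will be the signs in the four trigonometric sums. *)
Lemma qkernel_integral4 mu nu y (e0 e1 e2 e3 : quat R) h : qintegrable h ->
  let k a b (x : plane) := qkernel mu nu y (plane_sign (a, b) x) in
  let B (x : plane) :=
    (e0 * k 0 0 x + e1 * k 0 1 x + e2 * k 1 0 x + e3 * k 1 1 x) * h x in
  quat_integrable m B /\ quat_integral m B =
    e0 * qkernel_integral mu nu y 0 0 h + e1 * qkernel_integral mu nu y 0 1 h
    + e2 * qkernel_integral mu nu y 1 0 h + e3 * qkernel_integral mu nu y 1 1 h.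
Proof.
move=> hi k B.
have kb a b : quat_bounded_measurable (k a b) by exact: qkernel_sign_bounded.
have ki a b e : quat_integrable m (fun x => e * (k a b x * h x)).
  apply: quat_integrableMl; first exact: quat_bounded_measurable_cst.
  exact: quat_integrableMl (kb a b) hi.
have -> : B = fun x : plane => e0 * (k 0 0 x * h x) + e1 * (k 0 1 x * h x)
    + e2 * (k 1 0 x * h x) + e3 * (k 1 1 x * h x).
  by apply/funext => x; rewrite /B !mulrDl -!mulrA.
split; first by do !apply: quat_integrableD; exact: ki.
rewrite !quat_integralD; do ?[exact: ki | apply: quat_integrableD].
by rewrite !quat_integralMl//; exact: quat_integrableMl (kb _ _) hi.
Qed.

Lemma qkernel_sign mu nu (y : R * R) (a b : 'I_2) (s : R * R) :
  qkernel mu nu y (plane_sign (a, b) s) =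
  qexp mu (- ((-1) ^+ a * (s.1 * y.1))) * qexp nu (- ((-1) ^+ b * (s.2 * y.2))).
Proof. by rewrite /qkernel /plane_sign /= !mulrA. Qed.

(** This is [qexp_kernelD] with each trigonometric factor replaced by its sum over reflections of
    [s]. Its minus signs are absorbed by the squares of [nu], [mu] and [mu * nu], all equal to -1;
    the flipped exponent appears as a reflection of [t] in the second coordinate. *)
Lemma qkernelD mu nu (y s t : R * R) (p q : quat R) :
  mu ^+ 2 = -1 -> nu ^+ 2 = -1 -> mu * nu + nu * mu = 0 ->
  let k a b x := qkernel mu nu y (plane_sign (a, b) x) in
  4 *: (qkernel mu nu y (s + t) * (p * q)) =
    (k 0 0 t * p) * ((k 0 0 s + k 0 1 s + k 1 0 s + k 1 1 s) * q)
    + (k 0 0 t * (nu * p)) *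
      ((- k 0 0 s + k 0 1 s - k 1 0 s + k 1 1 s) * (nu * q))
    + (k 0 1 t * (mu * p)) *
      ((- k 0 0 s - k 0 1 s + k 1 0 s + k 1 1 s) * (mu * q))
    + (k 0 1 t * (nu * mu * p)) *
      ((k 0 0 s - k 0 1 s - k 1 0 s + k 1 1 s) * (mu * nu * q)).
Proof.
move=> mu2 nu2 mn k; rewrite {}/k !qkernel_sign /= !expr0 !expr1 !mul1r !mulN1r.
rewrite !opprK ![_ * (nu * q)]mulrA ![_ * (mu * q)]mulrA ![_ * (mu * nu * q)]mulrA.
have mn2 : (mu * nu) ^+ 2 = -1.
  move/eqP: (mn); rewrite addr_eq0 => /eqP mnE.
  by rewrite expr2 {1}mnE mulNr -mulrA (mulrA mu) -expr2 mu2 mulN1r mulrN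
    -expr2 nu2 opprK.
have -> : qkernel mu nu y (s + t) =
    qexp mu (- (s.1 * y.1 + t.1 * y.1)) * qexp nu (- (s.2 * y.2 + t.2 * y.2)).
  by rewrite /qkernel -!mulrDl.
move: (s.1 * y.1) (s.2 * y.2) (t.1 * y.1) (t.2 * y.2) => c d a b.
rewrite (sum_cos_cos mu nu c d) (sum_cos_sin mu nu c d) (sum_sin_cos mu nu c d).
rewrite (sum_sin_sin mu nu c d) mu2 nu2 mn2 !scalerN !mulNr !mulrN !mulr_algl.
rewrite (@scalerAl R (quat R)) (qexp_kernelD a b c d mu2 nu2 mn).
move: (4 * _) (4 * _) (4 * _) (4 * _) => r1 r2 r3 r4.
by rewrite !mulrBl -!(@scalerAl R (quat R)) -!(@scalerAr R (quat R)) !mulrA.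
Qed.

Lemma qfourier_convolution_split mu nu f g y :
  mu ^+ 2 = -1 -> nu ^+ 2 = -1 -> mu * nu + nu * mu = 0 ->
  qintegrable f -> qintegrable g ->
  let J a b h := qkernel_integral mu nu y a b h in
  qfourier mu nu (qconv f g) y = (2 * pi)^-1 *: (4^-1 *: (
    J 0 0 f * (J 0 0 g + J 0 1 g + J 1 0 g + J 1 1 g)
  + J 0 0 (nu \*o f) * (- J 0 0 (nu \*o g) + J 0 1 (nu \*o g)
      - J 1 0 (nu \*o g) + J 1 1 (nu \*o g))
  + J 0 1 (mu \*o f) * (- J 0 0 (mu \*o g) - J 0 1 (mu \*o g)
      + J 1 0 (mu \*o g) + J 1 1 (mu \*o g))
  + J 0 1 ((nu * mu) \*o f) * (J 0 0 ((mu * nu) \*o g)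
      - J 0 1 ((mu * nu) \*o g) - J 1 0 ((mu * nu) \*o g)
      + J 1 1 ((mu * nu) \*o g)))).
Proof.
move=> mu2 nu2 mn fi gi J; rewrite (qfourier_convolution mu nu y fi gi).
apply: (congr1 (fun q => (2 * pi)^-1 *: q)).
have Ai a b h : qintegrable h -> quat_integrable m
    (fun x => qkernel mu nu y (plane_sign (a, b) x) * h x).
  exact: quat_integrableMl (qkernel_sign_bounded mu nu y (a, b)).
have [B1 E1] := qkernel_integral4 mu nu y 1 1 1 1 gi.
have [B2 E2] := qkernel_integral4 mu nu y (-1) 1 (-1) 1 (qintegrableZ nu gi).
have [B3 E3] := qkernel_integral4 mu nu y (-1) (-1) 1 1 (qintegrableZ mu gi).
have [B4 E4] := qkernel_integral4 mu nu y 1 (-1) (-1) 1 (qintegrableZ (mu * nu) gi).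
(* The constant 1/4 cancels the factor 4 of [qkernelD]. *)
have := quat_integral_separable4 (4^-1)%:A (Ai 0 0 f fi)
  (Ai 0 0 _ (qintegrableZ nu fi)) (Ai 0 1 _ (qintegrableZ mu fi))
  (Ai 0 1 _ (qintegrableZ (nu * mu) fi)) B1 B2 B3 B4.
rewrite E1 E2 E3 E4 !mul1r !mulN1r mulr_algl => <-.
apply: eq_quat_integral => t; apply: eq_quat_integral => s.
rewrite !mul1r !mulN1r -(qkernelD y s t (f t) (g s) mu2 nu2 mn).
by rewrite mulr_algl scalerA mulVf ?scale1r.
Qed.

End FourierKernel.

(** * The convolution theorem *)

Theorem theorem5p1 (R : realType) (mu nu : quat R)
    (hmu : mu ^+ 2 = -1) (hnu : nu ^+ 2 = -1) (hmunu : mu * nu + nu * mu = 0)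
    (f g : R * R -> quat R) (hf : qintegrable f) (hg : qintegrable g)
    (y : R * R) :
  let F (h : R * R -> quat R) : quat R := qfourier mu nu h y in
  F (qconv f g) = (pi / 2) *:
    (  F f * F g
     + F f * F (g^[0, 1])
     + F f * F (g^[1, 0])
     + F f * F (g^[1, 1])
     - F (nu \*o f) * F (nu \*o g)
     + F (nu \*o f) * F (nu \*o g^[0, 1])
     - F (nu \*o f) * F (nu \*o g^[1, 0])
     + F (nu \*o f) * F (nu \*o g^[1, 1])
     - F (mu \*o f^[0, 1]) * F (mu \*o g)
     - F (mu \*o f^[0, 1]) * F (mu \*o g^[0, 1])
     + F (mu \*o f^[0, 1]) * F (mu \*o g^[1, 0])
     + F (mu \*o f^[0, 1]) * F (mu \*o g^[1, 1])
     + F ((nu * mu) \*o f^[0, 1]) * F ((mu * nu) \*o g)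
     - F ((nu * mu) \*o f^[0, 1]) * F ((mu * nu) \*o g^[0, 1])
     - F ((nu * mu) \*o f^[0, 1]) * F ((mu * nu) \*o g^[1, 0])
     + F ((nu * mu) \*o f^[0, 1]) * F ((mu * nu) \*o g^[1, 1])).
Proof.
move=> F.
have FE h : qintegrable h -> F h = (2 * pi)^-1 *: qkernel_integral mu nu y 0 0 h.
  exact: qfourierE.
have FrE a b h : qintegrable h ->
    F (reflection (a, b) h) = (2 * pi)^-1 *: qkernel_integral mu nu y a b h.
  exact: qfourier_reflection.
have FpE (p : quat R) a b (h : R * R -> quat R) : qintegrable h ->
    F (p \*o reflection (a, b) h) =
    (2 * pi)^-1 *: qkernel_integral mu nu y a b (p \*o h).
  (* Left multiplication by a constant commutes with reflection by definition. *)
  by move=> hi; exact: FrE (qintegrableZ p hi).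
rewrite [LHS](qfourier_convolution_split y hmu hnu hmunu hf hg).
(* Reflected terms are rewritten first, since [FE] would match every transform. *)
rewrite !FpE// !FrE// !FE//; do ?exact: qintegrableZ.
move: (qkernel_integral mu nu y) {FE FrE FpE} => J.
rewrite -!(@scalerAl R (quat R)) -!(@scalerAr R (quat R)) !scalerA.
rewrite -!scalerN -!scalerDr scalerA; congr (_ *: _).
  (* Both constants equal 1 / (8 pi): on the left 1 / (2 pi) times 1/4, on the right pi / 2 times
     the square of 1 / (2 pi). *)
  by move: (@pi R) (lt0r_neq0 (pi_gt0 R)) => c c0; field.
by rewrite !mulrDr !mulrN !addrA.
Qed.
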